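(* For every multilinear tableau $T$, $$c_q(T)=\sum_{\mathcal{A}\,:\,\mathcal{T}(\mathcal{A})=T} q^{v(\mathcal{A})},$$ the sum being over all set partitions $\mathcal{A}$ of $\mathrm{supp}(T)$ with $\mathcal{T}(\mathcal{A})=T$.
   Context: A multilinear tableau of shape $\lambda=(\lambda_1,\dots,\lambda_m)$ is an array $T=(T_{ij})_{1\le i\le m,1\le j\le\lambda_i}$ of distinct positive integers, rows increasing left to right and columns increasing top to bottom; its support $\mathrm{supp}(T)$ is the set of its entries. For $2\le j\le\lambda_i$ let $c_{ij}(T)=\#\{i'\ge i:\text{cell }(i',j-1)\text{ exists and }T_{i',j-1}<T_{ij}\}$, and $c_q(T)=\prod_i\prod_{j=2}^{\lambda_i}[c_{ij}(T)]_q$ with $[a]_q=1+q+\dots+q^{a-1}$. For a set partition $\mathcal{A}$ of a finite set $S\subset\mathbb{N}$ with blocks $A_1,\dots,A_m$ (listed in increasing order of least elements), $\mathcal{T}(\mathcal{A})$ is the tableau obtained by writing the elements of $A_i$ in increasing order in row $i$, and then sorting each column into increasing order and top-justifying it (so column $j$ consists of the $j$-th smallest elements of all blocks of size $\ge j$, sorted increasingly). Let $\mathbb{N}^*=\mathbb{N}\cup\{\infty\}$ with $\infty$ larger than all integers. Arcs $(a,b)$ and $(c,d)$ cross if $a<c<b<d$ or $c<a<d<b$. For a set $A=\{a_1<\dots<a_l\}$, its $j$-th arc is $(a_j,a_{j+1})$ for $j<l$ and $(a_l,\infty)$ for $j=l$. An interlacing of $\mathcal{A}=A_1|\dots|A_m$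 is a pair consisting of the $j$-th arc of $A_i$ and the $j$-th arc of $A_{i'}$ that cross, for some $i<i'$ and $1\le j\le\min(|A_i|,|A_{i'}|)$; $v(\mathcal{A})$ is the number of interlacings. *)

(* Defs.v *)
From mathcomp Require Import all_boot all_order all_algebra finmap.

Set Implicit Arguments.
Unset Strict Implicit.
Unset Printing Implicit Defensive.

Import GRing.Theory.
Local Open Scope nat_scope.

(* An array of integers is the sequence of its rows. Rows, columns and arcs
   are numbered from 0. *)
Definition array := seq (seq nat).

Definition cell (T : array) (i j : nat) : bool := j < size (nth [::] T i).

Definition entry (T : array) (i j : nat) : nat := nth 0 (nth [::] T i) j.

Definition is_integer_partition (la : seq nat) : bool :=
  sorted geq la && (0 \notin la).

Definition multilinear_tableau (T : array) : Prop :=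
  [/\ is_integer_partition (shape T),
      0 \notin flatten T,
      uniq (flatten T),
      forall i j, cell T i j.+1 -> entry T i j < entry T i j.+1
    & forall i j, cell T i.+1 j -> entry T i j < entry T i.+1 j].

Definition supp (T : array) : {fset nat} := [fset x in flatten T]%fset.

Definition c_stat (T : array) (i j : nat) : nat :=
  \sum_(i <= i' < size T |
         cell T i' j.-1 && (entry T i' j.-1 < entry T i j)) 1.

Definition q_int (a : nat) : {poly int} := (\sum_(k < a) 'X^k)%R.

(* The inner range 1 <= j is the range 2 <= j of the numbering from 1. *)
Definition c_q (T : array) : {poly int} :=
  (\prod_(i < size T) \prod_(1 <= j < size (nth [::] T i))
     q_int (c_stat T i j))%R.

(* A set partition of S is an A : {set {set S}} with partition A [set: S].
   [blocks A] lists its blocks by increasing least element, each block being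
   itself listed in increasing order. *)
Definition block_seq (S : {fset nat}) (B : {set S}) : seq nat :=
  sort leq [seq val x | x in B].

Definition blocks (S : {fset nat}) (A : {set {set S}}) : array :=
  sort (fun s t => head 0 s <= head 0 t) [seq block_seq B | B : {set S} in A].

Definition sorted_column (bs : array) (j : nat) : seq nat :=
  sort leq [seq nth 0 s j | s <- bs & j < size s].

Definition sorted_columns (bs : array) : seq (seq nat) :=
  mkseq (sorted_column bs) (\max_(s <- bs) size s).

Definition sort_columns (bs : array) : array :=
  mkseq (fun i => [seq nth 0 col i | col <- sorted_columns bs & i < size col])
        (size bs).

Definition tableau_of (S : {fset nat}) (A : {set {set S}}) : array :=
  sort_columns (blocks A).

(* N^* = N \cup {oo}, with None for oo. *)
Definition Nstar := option nat.

Definition ltNstar (x y : Nstar) : bool :=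
  match x, y with
  | Some a, Some b => a < b
  | Some _, None => true
  | None, _ => false
  end.

Definition cross (e f : Nstar * Nstar) : bool :=
  let: (a, b) := e in
  let: (c, d) := f in
  [&& ltNstar a c, ltNstar c b & ltNstar b d]
  || [&& ltNstar c a, ltNstar a d & ltNstar d b].

(* For j = (size s).-1, onth s j.+1 is None, i.e. oo. *)
Definition nth_arc (s : seq nat) (j : nat) : Nstar * Nstar :=
  (onth s j, onth s j.+1).

Definition interlacings (bs : array) : nat :=
  \sum_(i < size bs) \sum_(i.+1 <= i' < size bs)
    \sum_(j < minn (size (nth [::] bs i)) (size (nth [::] bs i')))
      cross (nth_arc (nth [::] bs i) j) (nth_arc (nth [::] bs i') j).

Definition v_stat (S : {fset nat}) (A : {set {set S}}) : nat :=
  interlacings (blocks A).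

(* Main.v *)
Require Import Defs.
From mathcomp Require Import all_boot all_order all_algebra finmap.
From mathcomp Require Import zify.

(* Record a tableau, or the sorted blocks of a set partition, by its cells
   [(j, x)]: the entry [x] occurs in column [j]. A partition A has T(A) = T
   iff both have the same cells, so A is built by inserting the cells of T one
   at a time, columns from left to right and each column upwards in value.
   When [x] is inserted in column [j > 0] it is appended to a block of size [j]
   whose last element is smaller than [x]; there are [c] such blocks, where [c]
   is the statistic of the cell of T containing [x]. Appending [x] to the one
   with last element [a] replaces the arc (a, oo) by (a, x); the only crossings
   gained are with the open arcs (b, oo) of the other candidates with [a < b].
   Hence the c choices contribute 1 + q + ... + q^(c-1). *)

Set Implicit Arguments.
Unset Strict Implicit.
Unset Printing Implicit Defensive.

Import GRing.Theory.

(** * Arrays as multisets of cells, read column by column *)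

Definition row_cells (s : seq nat) : seq (nat * nat) :=
  [seq (j, nth 0 s j) | j <- iota 0 (size s)].

Definition cells (bs : array) : seq (nat * nat) :=
  flatten [seq row_cells s | s <- bs].

Definition column (w : seq (nat * nat)) (j : nat) : seq nat :=
  [seq y.2 | y <- w & y.1 == j].

Lemma row_cells_rcons s x :
  row_cells (rcons s x) = rcons (row_cells s) (size s, x).
Proof.
rewrite /row_cells size_rcons -addn1 iotaD map_cat cats1 /= nth_rcons add0n.
rewrite ltnn eqxx; congr rcons; apply/eq_in_map => j; rewrite mem_iota add0n.
by move=> /= lt_js; rewrite nth_rcons lt_js.
Qed.

Lemma cells_cat b1 b2 : cells (b1 ++ b2) = cells b1 ++ cells b2.
Proof. by rewrite /cells map_cat flatten_cat. Qed.

Lemma mem_cells bs j x :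
  reflect (exists2 s, s \in bs & j < size s /\ nth 0 s j = x)
          ((j, x) \in cells bs).
Proof.
apply: (iffP flatten_mapP) => [[s sbs]|[s sbs [js <-]]].
  case/mapP=> k; rewrite mem_iota add0n /= => ks [-> ->]; by exists s.
by exists s => //; apply/mapP; exists j; rewrite // mem_iota.
Qed.

Lemma cells_snd bs : [seq y.2 | y <- cells bs] = flatten bs.
Proof.
rewrite /cells map_flatten -map_comp; congr flatten.
rewrite -[RHS]map_id; apply: eq_map => s /=.
by rewrite /row_cells -map_comp (eq_map (g := nth 0 s)) // map_nth_iota0 ?take_size.
Qed.

Lemma column_cells bs j :
  column (cells bs) j = [seq nth 0 s j | s <- bs & j < size s].
Proof.
rewrite /column; elim: bs => //= s bs IH.
rewrite -cat1s cells_cat filter_cat map_cat IH /cells /= cats0.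
rewrite /row_cells filter_map -map_comp.
rewrite (eq_filter (a2 := pred1 j)) //.
case: ltnP => js.
  by rewrite filter_pred1_uniq ?iota_uniq // mem_iota.
by rewrite (@eq_in_filter _ _ pred0) ?filter_pred0 // => k;
   rewrite mem_iota /= => ks; apply/eqP => e; lia.
Qed.

Lemma count_column (w : seq (nat * nat)) j (p : pred nat) :
  count p (column w j) = count (fun y => (y.1 == j) && p y.2) w.
Proof.
rewrite /column count_map count_filter; apply: eq_count => y /=.
by rewrite andbC.
Qed.

Lemma perm_column w w' j : perm_eq w w' -> perm_eq (column w j) (column w' j).
Proof. by move=> /seq.permP eq_ww; apply/seq.permP => p; rewrite !count_column. Qed.

Lemma perm_columns w w' :
  (forall j, perm_eq (column w j) (column w' j)) -> perm_eq w w'.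
Proof.
move=> H; apply/allP => -[j x] _ /=; apply/eqP.
have e v : count_mem (j, x) v = count_mem x (column v j).
  by rewrite count_column; apply: eq_count => -[a b].
by rewrite !e; apply/seq.permP/H.
Qed.

(** * The insertion order and the arrays that it generates *)

(** A list sorted by this order is decreasing, so its head is the cell inserted last and its tail is
    the previous stage of the construction. *)
Definition lexgt (y z : nat * nat) : bool :=
  (z.1 < y.1) || (z.1 == y.1) && (z.2 < y.2).

Lemma lexgt_trans : transitive lexgt.
Proof. by move=> [a b] [c d] [e f]; rewrite /lexgt /=; lia. Qed.

(** An intrinsic description, without a ground set, of the lists [blocks A]: for distinct entries,
    [blocks_onto] turns such an array into a set partition. *)
Definition block_array (w : seq (nat * nat)) (bs : array) : bool :=
  [&& all (sorted ltn) bs, [::] \notin bs, sorted ltn [seq head 0 s | s <- bs]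
    & perm_eq (cells bs) w].

(** Here [n] is the column that the new entry [x] would occupy. It is positive wherever this is
    used, so the default value of [last] never matters. *)
Definition available (n x : nat) (s : seq nat) : bool :=
  (size s == n) && (last 0 s < x).

(** The row is selected by its value: increasing heads make the rows of a block array distinct, so
    exactly one row changes when [s] is one of them. *)
Definition extend (x : nat) (s : seq nat) (bs : array) : array :=
  [seq if t == s then rcons t x else t | t <- bs].

(* The last cell of [w] is placed first. *)
Fixpoint block_arrays (w : seq (nat * nat)) : seq array :=
  match w with
  | [::] => [:: [::]]
  | (0, x) :: w' => [seq rcons bs [:: x] | bs <- block_arrays w']
  | (n, x) :: w' =>
      [seq extend x s bs | bs <- block_arrays w', s <- filter (available n x) bs]
  end.

(** * Inserting and removing the latest cell *)

Lemma rows_uniq bs : sorted ltn [seq head 0 s | s <- bs] -> uniq bs.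
Proof.
move=> /(sorted_uniq ltn_trans ltnn) u; exact: map_uniq u.
Qed.

Lemma extend_cat x s b1 b2 : uniq (b1 ++ s :: b2) ->
  extend x s (b1 ++ s :: b2) = b1 ++ rcons s x :: b2.
Proof.
rewrite -cat_rcons /extend.
have idm b : s \notin b -> [seq if t == s then rcons t x else t | t <- b] = b.
  move=> sb; rewrite -[RHS]map_id; apply/eq_in_map => t tb.
  by case: eqP => // e; rewrite -e tb in sb.
rewrite cat_uniq rcons_uniq => /and3P[/andP[s1 _]].
move=> /hasPn s2 _; rewrite map_cat map_rcons eqxx !idm // ?cat_rcons //.
by apply/negP => /s2; rewrite /= mem_rcons inE eqxx.
Qed.

Lemma cells_mid b1 s b2 :
  perm_eq (cells (b1 ++ s :: b2)) (row_cells s ++ cells (b1 ++ b2)).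
Proof. by rewrite !cells_cat /cells /= perm_catCA. Qed.

Lemma cells_mid_rcons b1 s x b2 :
  perm_eq (cells (b1 ++ rcons s x :: b2))
          ((size s, x) :: cells (b1 ++ s :: b2)).
Proof.
apply: perm_trans (cells_mid _ _ _) _.
rewrite row_cells_rcons -cats1 -catA perm_catCA perm_cons perm_sym.
exact: cells_mid.
Qed.

(** Every cell of [w] lies in column 0 and is below [x], so the heads remain increasing when [x] is
    put last as a row of its own. *)
Lemma block_array_add_row x w bs : all (lexgt (0, x)) w ->
  block_array w bs -> block_array ((0, x) :: w) (rcons bs [:: x]).
Proof.
move=> /allP max_x /and4P[srt ne hd pm]; apply/and4P; split.
- by rewrite all_rcons.
- by rewrite mem_rcons inE.
- rewrite map_rcons /=; case: bs hd {srt} ne pm => //= s bs hd ne pm.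
  rewrite rcons_path hd /= (last_map (head 0)).
  have := mem_last s bs; set t := last s bs => tb.
  have /max_x: (0, head 0 t) \in w.
    rewrite -(perm_mem pm); apply/mem_cells; exists t => //.
    rewrite nth0; split=> //; rewrite lt0n size_eq0.
    by apply: contraNneq ne => <-.
  by rewrite /lexgt /=.
- by rewrite -cats1 cells_cat cats1 perm_rcons perm_cons.
Qed.

(** All cells lie in column 0, so every row is a singleton; the heads increase and [x] is the
    largest of them, hence it forms the last row. *)
Lemma block_array_del_row x w bs : all (lexgt (0, x)) w ->
  block_array ((0, x) :: w) bs ->
  exists2 bs', bs = rcons bs' [:: x] & block_array w bs'.
Proof.
move=> /allP max_x /and4P[srt ne hd pm].
have single s : s \in bs -> s = [:: head 0 s].
  case: s => [|a [|b s]] sbs //; first by rewrite sbs in ne.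
  have : (1, b) \in cells bs by apply/mem_cells; exists [:: a, b & s].
  by rewrite (perm_mem pm) inE => /orP[/eqP//|/max_x]; rewrite /lexgt.
have heads s : s \in bs -> (0, head 0 s) \in (0, x) :: w.
  move=> sbs; rewrite -(perm_mem pm); apply/mem_cells; exists s => //.
  by rewrite (single s sbs).
case/lastP: bs srt ne hd pm single heads => [|bs t] srt ne hd pm single heads.
  by have := perm_size pm.
have t_in : t \in rcons bs t by rewrite mem_rcons mem_head.
have et := single t t_in; have tx : head 0 t = x.
  have : (0, x) \in cells (rcons bs t) by rewrite (perm_mem pm) mem_head.
  case/mem_cells=> s sb [_]; rewrite nth0; move: sb; rewrite mem_rcons inE.
  case/orP=> [/eqP -> //|sb hs].
  have : head 0 s < head 0 t.
    move: hd; rewrite map_rcons -cats1 (sorted_pairwise ltn_trans).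
    rewrite pairwise_cat => /and3P[/allrelP H _ _].
    by apply: H; rewrite ?mem_head // map_f.
  have := heads t t_in; rewrite inE.
  by case/orP=> [/eqP[]//|/max_x]; rewrite /lexgt /=; lia.
exists bs; first by rewrite et tx.
move: srt ne hd pm; rewrite all_rcons map_rcons => /andP[_ srt].
rewrite mem_rcons inE negb_or => /andP[_ ne] hd pm; apply/and4P; split=> //.
  by move: hd; rewrite -cats1 => /cat_sorted2[].
by move: pm; rewrite et tx -cats1 cells_cat cats1 perm_rcons perm_cons.
Qed.

Lemma block_array_snd w bs :
  block_array w bs -> perm_eq (flatten bs) [seq y.2 | y <- w].
Proof. by case/and4P=> _ _ _ pm; rewrite -cells_snd perm_map. Qed.

Lemma head_rcons_nonempty (s : seq nat) x : s != [::] ->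
  head 0 (rcons s x) = head 0 s.
Proof. by case: s. Qed.

Lemma sorted_ltn_rcons s x : s != [::] ->
  sorted ltn (rcons s x) = (last 0 s < x) && sorted ltn s.
Proof. by case: s => //= a s _; rewrite rcons_path andbC. Qed.

Lemma block_array_extend n x s w bs :
  s \in bs -> available n.+1 x s -> block_array w bs ->
  block_array ((n.+1, x) :: w) (extend x s bs).
Proof.
move=> sbs /andP[/eqP sz lt_x] /and4P[srt ne hd pm].
have u := rows_uniq hd.
case/splitPr: sbs u srt ne hd pm => b1 b2 u srt ne hd pm.
have s_ne : s != [::] by rewrite -size_eq0 sz.
rewrite extend_cat //; apply/and4P; split.
- move: srt; rewrite !all_cat /= => /and3P[-> srt ->].
  by rewrite sorted_ltn_rcons // lt_x srt.
- move: ne; rewrite !mem_cat !inE !negb_or => /and3P[-> _ ->].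
  by rewrite eq_sym -size_eq0 size_rcons.
- by move: hd; rewrite !map_cat /= head_rcons_nonempty.
- by apply: perm_trans (cells_mid_rcons _ _ _ _) _; rewrite sz perm_cons.
Qed.

(** A row continuing past column [n.+1] would contain a cell later than [(n.+1, x)]. Hence [x] ends
    its row, and deleting it undoes an [extend]. *)
Lemma block_array_shrink n x w bs : all (lexgt (n.+1, x)) w ->
  block_array ((n.+1, x) :: w) bs ->
  exists bs' s, [/\ block_array w bs', s \in bs', available n.+1 x s
                  & bs = extend x s bs'].
Proof.
move=> /allP max_x /and4P[srt ne hd pm].
have : (n.+1, x) \in cells bs by rewrite (perm_mem pm) mem_head.
case/mem_cells=> s' s'bs [lt_n nth_x].
have sz : size s' = n.+2.
  apply/eqP; rewrite eqn_leq lt_n andbT leqNgt; apply/negP => gt_n.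
  have : (n.+2, nth 0 s' n.+2) \in cells bs by apply/mem_cells; exists s'.
  rewrite (perm_mem pm) inE => /orP[/eqP[]|/max_x]; first by lia.
  by rewrite /lexgt /=; lia.
case/lastP: s' => [|s x'] in s'bs lt_n nth_x sz; first by [].
move: sz nth_x; rewrite size_rcons => -[sz].
rewrite nth_rcons sz ltnn eqxx => ex; rewrite {}ex in s'bs lt_n.
have s_ne : s != [::] by rewrite -size_eq0 sz.
case/splitPr: s'bs srt ne hd pm => b1 b2 srt ne hd pm.
have hd' : sorted ltn [seq head 0 s | s <- b1 ++ s :: b2].
  by move: hd; rewrite !map_cat /= head_rcons_nonempty.
move: srt; rewrite all_cat /= sorted_ltn_rcons // -andbA.
case/and4P=> srt1 lt_x srt srt2.
exists (b1 ++ s :: b2), s; split.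
- apply/and4P; split=> //.
  + by rewrite all_cat /= srt1 srt.
  + move: ne; rewrite !mem_cat !inE !negb_or => /and3P[-> _ ->].
    by rewrite eq_sym s_ne.
  + rewrite -(perm_cons (n.+1, x)); apply: perm_trans pm.
    by rewrite perm_sym -sz cells_mid_rcons.
- by rewrite mem_cat mem_head orbT.
- by rewrite /available sz eqxx.
- by rewrite extend_cat // rows_uniq.
Qed.

(** * The enumeration is complete and free of repetitions *)

(** Induction on [w]: each insertion is inverted by removing the latest cell, which leaves a shorter
    list of rows in column 0 and a shorter row elsewhere. *)
Lemma mem_block_arrays w bs : sorted lexgt w ->
  (bs \in block_arrays w) = block_array w bs.
Proof.
elim: w bs => [|[n x] w IH] bs srt.
  rewrite /= inE; apply/eqP/idP => [->//|/and4P[_ ne _]].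
  case: bs ne => // -[|a s] bs; first by rewrite mem_head.
  by move=> _ /perm_size.
have max_x : all (lexgt (n, x)) w := order_path_min lexgt_trans srt.
have {}IH bs' := IH bs' (path_sorted srt).
case: n srt max_x => [|n] srt max_x.
  apply/mapP/idP => [[bs' + ->]|/(block_array_del_row max_x)[bs' -> good']].
    by rewrite IH; apply: block_array_add_row.
  by exists bs'; rewrite ?IH.
apply/allpairsPdep/idP => [[bs' [s [+ + ->]]]|].
  rewrite IH mem_filter => good' /andP[av sbs].
  exact: block_array_extend.
case/(block_array_shrink max_x) => bs' [s [good' sbs av ->]].
by exists bs', s; rewrite IH mem_filter av.
Qed.

Lemma mem_extend x s bs : s \in bs -> rcons s x \in extend x s bs.
Proof. by move=> sbs; apply/mapP; exists s; rewrite // eqxx. Qed.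

(** Deleting a fresh [x] from every row recovers the array without knowing which row was extended;
    this is what makes insertion injective. *)
Lemma extendK x s bs : x \notin flatten bs ->
  [seq [seq y <- t | y != x] | t <- extend x s bs] = bs.
Proof.
move=> xbs; rewrite /extend -map_comp -[RHS]map_id; apply/eq_in_map => t tbs /=.
have xt : [seq y <- t | y != x] = t.
  apply/all_filterP/allP => y yt; apply: contraNneq xbs => <-.
  by apply/flattenP; exists t.
by case: eqP => // _; rewrite filter_rcons eqxx.
Qed.

(** Once the arrays agree, the extended row is recognised as the only one containing [x]. *)
Lemma extend_inj x s s' bs bs' : x \notin flatten bs -> x \notin flatten bs' ->
  s \in bs -> s' \in bs' -> extend x s bs = extend x s' bs' ->
  bs = bs' /\ s = s'.
Proof.
move=> xbs xbs' sbs sbs' e.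
have eb : bs = bs' by rewrite -(extendK s xbs) e extendK.
split=> //; have := mem_extend x sbs; rewrite e => /mapP[t tbs].
case: eqP => [-> /rcons_inj[]//|_ et].
by case/flattenP: xbs'; exists t; rewrite // -et mem_rcons mem_head.
Qed.

Lemma block_arrays_uniq w : sorted lexgt w -> uniq [seq y.2 | y <- w] ->
  uniq (block_arrays w).
Proof.
elim: w => [|[n x] w IH] // srt /= /andP[xw uw].
have srt' := path_sorted srt.
have fresh bs : bs \in block_arrays w -> x \notin flatten bs.
  by rewrite mem_block_arrays // => /block_array_snd/perm_mem->.
case: n srt => [|n] srt; first by rewrite map_inj_uniq ?IH // => a b /rcons_inj[].
apply: allpairs_uniq_dep => [|bs|]; first exact: IH.
  rewrite mem_block_arrays // => /and4P[_ _ /rows_uniq u _].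
  exact: filter_uniq.
move=> _ _ /allpairsPdep[bs [s [bsE + ->]]] /allpairsPdep[bs' [s' [bsE' + ->]]] /=.
rewrite !mem_filter => /andP[_ sbs] /andP[_ sbs'] e.
by have [-> ->] := extend_inj (fresh _ bsE) (fresh _ bsE') sbs sbs' e.
Qed.

(** * Crossings gained by an insertion *)

Definition crossings (s t : seq nat) : nat :=
  \sum_(j < minn (size s) (size t)) cross (nth_arc s j) (nth_arc t j).

(** The index sums of [interlacings] recast as a recursion on the list, from which a single row can
    be isolated by symmetry of crossing. *)
Fixpoint pair_crossings (bs : array) : nat :=
  if bs is s :: bs' then
    \sum_(t <- bs') crossings s t + pair_crossings bs'
  else 0.

Lemma interlacingsE bs : interlacings bs = pair_crossings bs.
Proof.
elim: bs => [|s bs IH]; first by rewrite /interlacings big_ord0.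
rewrite /interlacings /= big_ord_recl; congr (_ + _).
  by rewrite big_add1 /= (big_nth [::]); apply: eq_bigr.
by rewrite -IH; apply: eq_bigr => i _; rewrite big_add1.
Qed.

Lemma cross_sym e f : cross e f = cross f e.
Proof. by case: e f => a b [c d]; rewrite /cross orbC. Qed.

Lemma crossings_sym s t : crossings s t = crossings t s.
Proof.
by rewrite /crossings minnC; apply: eq_bigr => j _; rewrite cross_sym.
Qed.

Lemma pair_crossings_mid b1 s b2 : pair_crossings (b1 ++ s :: b2) =
  \sum_(t <- b1 ++ b2) crossings s t + pair_crossings (b1 ++ b2).
Proof.
elim: b1 => //= r b1 IH; rewrite IH big_cons !big_cat big_cons /=.
rewrite (crossings_sym r s); lia.
Qed.

Lemma onth_rcons (s : seq nat) x j :
  onth (rcons s x) j = if j < size s then onth s j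
                       else if j == size s then Some x else None.
Proof. by elim: s j => [|a s IH] [|j] //=; rewrite ?eqSS ?IH //; case: j. Qed.

Lemma onth_lt (s : seq nat) j : j < size s -> onth s j = Some (nth 0 s j).
Proof. by elim: s j => [|a s IH] [|j] //= /IH. Qed.

Lemma onth_ge (s : seq nat) j : size s <= j -> onth s j = None.
Proof. by elim: s j => [|a s IH] [|j] //= /IH. Qed.

(* Only the open arc (last s, oo) becomes (last s, x); it gains a crossing
   exactly with the open arcs starting strictly between [last s] and [x]. *)
Lemma crossings_rcons n x s u : size s = n.+1 -> size u <= n.+2 ->
  (size u = n.+2 -> nth 0 u n.+1 < x) ->
  crossings (rcons s x) u =
  crossings s u + (available n.+1 x u && (last 0 s < last 0 u)).
Proof.
move=> ss su ux.
pose a k : bool := cross (nth_arc (rcons s x) k) (nth_arc u k).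
pose b k : bool := cross (nth_arc s k) (nth_arc u k).
rewrite [LHS](_ : _ = \sum_(j < minn n.+2 (size u)) a j); last first.
  by rewrite /crossings size_rcons ss.
rewrite [crossings s u](_ : _ = \sum_(j < minn n.+1 (size u)) b j); last first.
  by rewrite /crossings ss.
have same k : k < n -> a k = b k.
  by move=> kn; rewrite /a /b /nth_arc !onth_rcons ss !ifT //; lia.
rewrite /available -!nth_last ss.
(* A row [u] this short has no arc starting in column [n], where the change takes place. *)
have [un|] := leqP (size u) n.
  have -> : minn n.+2 (size u) = size u by lia.
  have -> : minn n.+1 (size u) = size u by lia.
  rewrite (_ : size u == n.+1 = false) ?addn0; last by lia.
  by apply: eq_bigr => j _; rewrite same //; have := ltn_ord j; lia.
rewrite leq_eqVlt => /orP[/eqP un|un].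
  rewrite -un minnn (minn_idPr (leqnSn _)) !big_ord_recr /= eqxx -addnA.
  congr (_ + _); first by apply: eq_bigr => j _; rewrite same.
  rewrite /a /b /nth_arc !onth_rcons ss ltnSn ltnn eqxx.
  rewrite !(@onth_lt _ n) ?(@onth_ge u n.+1) ?(@onth_ge s n.+1) -?un ?ss //.
  by rewrite /cross /ltNstar; lia.
(* Now arc [n] of [u] ends below [x], so replacing the end oo of the other arc by [x] does not
   affect crossing it; the two arcs in column [n.+1] are both open and do not cross. *)
have {}un : size u = n.+2 by lia.
rewrite un minnn (minn_idPl (leqnSn _)) !big_ord_recr /=.
rewrite (_ : _ == _ = false) /= ?addn0; last by lia.
rewrite -addnA; congr (_ + _); first by apply: eq_bigr => j _; rewrite same.
have {}ux := ux un.
rewrite /a /b /nth_arc !onth_rcons ss ltnSn ltnn eqxx.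
rewrite !(@onth_lt _ n) ?(@onth_lt u n.+1) ?ss ?un //.
have -> : n.+2 < n.+1 = false by lia.
have -> : n.+2 == n.+1 = false by lia.
by rewrite (@onth_ge u n.+2) ?(@onth_ge s n.+1) ?ss ?un // /cross /ltNstar; lia.
Qed.

(** Only pairs involving the extended row change. As [(n.+1, x)] is the latest cell, the other rows
    satisfy the size and value bounds that [crossings_rcons] requires. *)
Lemma interlacings_extend n x s w bs : all (lexgt (n.+1, x)) w ->
  block_array w bs -> s \in bs -> available n.+1 x s ->
  interlacings (extend x s bs) =
  interlacings bs +
  count (ltn (last 0 s)) [seq last 0 t | t <- bs & available n.+1 x t].
Proof.
move=> /allP max_x /and4P[_ _ hd pm] sbs av; rewrite !interlacingsE.
have bound u k : u \in bs -> k < size u ->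
    k <= n.+1 /\ (k = n.+1 -> nth 0 u k < x).
  move=> ubs ku; have : (k, nth 0 u k) \in w.
    by rewrite -(perm_mem pm); apply/mem_cells; exists u.
  by move/max_x; rewrite /lexgt /=; lia.
have u := rows_uniq hd; move: (sbs).
case/splitPr: bs / sbs u bound {hd pm} => b1 b2 u bound _.
rewrite extend_cat // !pair_crossings_mid -addnA [pair_crossings _ + _]addnC addnA.
congr (_ + _); rewrite count_map count_filter.
(* The row [s] drops out of the count, since its last entry is not larger than itself. *)
have -> : count (predI (preim (last 0) (ltn (last 0 s))) (available n.+1 x))
            (b1 ++ s :: b2) =
          \sum_(t <- b1 ++ b2) (available n.+1 x t && (last 0 s < last 0 t)).
  rewrite -sum1_count big_mkcond !big_cat big_cons /= ltnn add0n /=.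
  by congr (_ + _); apply: eq_bigr => t _; rewrite andbC; case: ifP.
rewrite -big_split /=; apply: eq_big_seq => t tb.
have tbs : t \in b1 ++ s :: b2 by move: tb; rewrite !mem_cat inE => /orP[]->; rewrite ?orbT.
case/andP: av => /eqP ss _; apply: crossings_rcons => //.
  rewrite leqNgt; apply/negP => st.
  by have [] := bound t n.+2 tbs st; lia.
by move=> st; have [|_] := bound t n.+1 tbs; [rewrite st | apply].
Qed.

(** At this stage each row has at most one entry, so its only arc is open, and two open arcs never
    cross. *)
Lemma interlacings_add_row x w bs : all (lexgt (0, x)) w ->
  block_array w bs -> interlacings (rcons bs [:: x]) = interlacings bs.
Proof.
move=> /allP max_x /and4P[_ _ hd pm]; rewrite !interlacingsE -cats1.
rewrite pair_crossings_mid cats0 big1_seq // => t /= tbs.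
have le1 : size t <= 1.
  rewrite leqNgt; apply/negP => st.
  have : (1, nth 0 t 1) \in w.
    by rewrite -(perm_mem pm); apply/mem_cells; exists t.
  by move/max_x.
rewrite /crossings; case: t le1 {tbs} => [|a [|]] //= _; first by rewrite big_ord0.
by rewrite big_ord1 /= !andbF.
Qed.

(** * The q-integer contributed by the choices for one cell *)

(** The number of larger elements takes each value from 0 to [size L - 1] once. In decreasing order
    the head has exponent 0 and raises every later exponent by one. *)
Lemma sum_rank_uniq (L : seq nat) : uniq L ->
  (\sum_(a <- L) 'X^(count (ltn a) L) = q_int (size L))%R.
Proof.
move=> uL; have pL : perm_eq (sort geq L) L by rewrite perm_sort.
have sL : sorted gtn (sort geq L).
  by rewrite gtn_sorted_uniq_geq sort_uniq uL sort_sorted // => a b; lia.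
rewrite -(perm_big _ pL) -(perm_size pL) /=.
under eq_bigr do rewrite -(seq.permP pL).
elim: (sort geq L) sL => [|a l IH] /= srt.
  by rewrite big_nil /q_int big_ord0.
have /allP max_a : all (gtn a) l by rewrite (order_path_min _ srt) // => b c d; lia.
rewrite big_cons ltnn add0n /q_int big_ord_recl; congr (_ + _)%R.
  suff -> : count (ltn a) l = 0 by [].
  by apply/eqP; rewrite -leqn0 leqNgt -has_count; apply/hasPn => b /max_a /=; lia.
rewrite [RHS](eq_bigr (fun i : 'I_(size l) => 'X * 'X^i)%R) => [|i _]; last first.
  by rewrite lift0 exprS.
rewrite -mulr_sumr -/(q_int _) -IH ?(path_sorted srt) // mulr_sumr.
by apply: eq_big_seq => b /max_a /= ->; rewrite exprS.
Qed.

(* Each cell of the same column smaller than [y] already follows one of the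
   counted cells of the previous column, so the subtraction never truncates. *)
Definition free_places (w : seq (nat * nat)) (y : nat * nat) : nat :=
  count (gtn y.2) (column w y.1.-1) - count (gtn y.2) (column w y.1).

(** A later cell lies neither in the column before that of [z] nor below the value of [z] in the
    same column, so both counts ignore it. Factors found at insertion time thus persist. *)
Lemma free_places_cons y z w : 0 < z.1 -> lexgt y z ->
  free_places (y :: w) z = free_places w z.
Proof.
case: y z => n x [[|m] y] //= _; rewrite /lexgt /free_places /= => yz.
by rewrite !count_column /=; lia.
Qed.

Lemma count_sum_bool (T : Type) (p : pred T) (s : seq T) :
  count p s = \sum_(t <- s) p t.
Proof. by elim: s => [|t s IH]; rewrite ?big_nil ?big_cons //= IH. Qed.

(** A row with an entry below [x] in column [n] either ends there, and is available, or continues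
    into column [n.+1], where its entry is again below [x] because [(n.+1, x)] is the latest
    cell. *)
Lemma size_available n x w bs : all (lexgt (n.+1, x)) w -> block_array w bs ->
  size [seq t <- bs | available n.+1 x t] =
  free_places ((n.+1, x) :: w) (n.+1, x).
Proof.
move=> /allP max_x /and4P[/allP srt _ _ pm].
rewrite /free_places !count_column /= ltnn !andbF !add0n.
rewrite -!(count_column w _ (gtn x)) -!(seq.permP (perm_column _ pm)).
rewrite !column_cells !count_map !count_filter size_filter.
set c0 := count _ bs; set c1 := count _ bs; set c2 := count _ bs.
suff -> : c1 = c0 + c2 by rewrite addnK.
rewrite /c0 /c1 /c2 !count_sum_bool -big_split /=.
apply: eq_big_seq => s sbs; rewrite /available.
have bound k : k < size s -> k <= n.+1 /\ (k = n.+1 -> nth 0 s k < x).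
  move=> ks; have : (k, nth 0 s k) \in w.
    by rewrite -(perm_mem pm); apply/mem_cells; exists s.
  by move/max_x; rewrite /lexgt /=; lia.
have le_s : size s <= n.+2.
  by rewrite leqNgt; apply/negP => /(bound n.+2)[]; lia.
case: (ltngtP (size s) n.+1) => [lt|gt|eq].
- by rewrite !andbF.
- have [_ /(_ erefl) lt_x] := bound n.+1 gt.
  have : nth 0 s n < nth 0 s n.+1.
    by apply: (sorted_ltn_nth ltn_trans 0 (srt s sbs)); rewrite ?inE // ltnW.
  by move=> lt; rewrite lt_x (ltn_trans lt lt_x).
- by rewrite -nth_last eq /= andbT andbF addn0.
Qed.

(** The last entry of an available row is its entry in column [n], and a strictly sorted [w] repeats
    no entry within a column. *)
Lemma available_last_uniq n x w bs : sorted lexgt w -> block_array w bs ->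
  uniq [seq last 0 t | t <- bs & available n.+1 x t].
Proof.
move=> srt /and4P[_ _ _ pm].
have uw : uniq (column w n).
  rewrite map_inj_in_uniq => [|[a b] [c d]]; last first.
    by rewrite !mem_filter /= => /andP[/eqP -> _] /andP[/eqP -> _] ->.
  apply/filter_uniq/(sorted_uniq lexgt_trans _ srt) => -[a b].
  by rewrite /lexgt /=; lia.
rewrite -(perm_uniq (perm_column n pm)) column_cells in uw.
apply: subseq_uniq uw.
have -> : [seq last 0 t | t <- bs & available n.+1 x t] =
          [seq nth 0 t n | t <- bs & available n.+1 x t].
  apply/eq_in_map => t; rewrite mem_filter => /andP[/andP[/eqP st _] _].
  by rewrite -nth_last st.
apply: map_subseq.
have -> : [seq t <- bs | available n.+1 x t] =
          [seq t <- [seq t <- bs | n < size t] | available n.+1 x t].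
  rewrite -filter_predI; apply: eq_filter => t /=.
  by rewrite /available; case: eqP => // ->; rewrite ltnSn andbT.
exact: filter_subseq.
Qed.

(** Induction removing the latest cell: in column 0 it has one place and adds no crossing; elsewhere
    the number of available rows depends only on [w], so one q-integer factors out of all arrays of
    the previous stage. *)
Lemma sum_block_arrays w : sorted lexgt w ->
  (\sum_(bs <- block_arrays w) 'X^(interlacings bs) =
   \prod_(y <- w | (0 < y.1)%N) q_int (free_places w y))%R.
Proof.
elim: w => [|[n x] w IH] srt.
  by rewrite /= big_seq1 big_nil interlacingsE.
have max_x : all (lexgt (n, x)) w := order_path_min lexgt_trans srt.
have srt' := path_sorted srt.
have {}IH := IH srt'.
have prodE : (\prod_(y <- w | (0 < y.1)%N) q_int (free_places ((n, x) :: w) y) =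
              \prod_(y <- w | (0 < y.1)%N) q_int (free_places w y))%R.
  rewrite big_seq_cond [RHS]big_seq_cond; apply: eq_bigr => y /andP[yw y0].
  by rewrite free_places_cons // (allP max_x).
rewrite big_cons prodE -IH {prodE IH}.
case: n srt max_x => [|n] srt max_x.
  rewrite /= big_map; apply: eq_big_seq => bs.
  rewrite mem_block_arrays // => good.
  by rewrite (interlacings_add_row max_x good).
rewrite [block_arrays _]/= big_allpairs_dep mulr_sumr; apply: eq_big_seq => bs.
rewrite mem_block_arrays // => good.
(* The q-integer is expanded over the last entries of the available rows, to match the gain in
   [interlacings_extend] term by term. *)
rewrite -(size_available max_x good) -(size_map (last 0)) -sum_rank_uniq; last first.
  exact: available_last_uniq good.
rewrite mulr_suml big_map; apply: eq_big_seq => s.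
rewrite mem_filter => /andP[av sbs].
by rewrite (interlacings_extend max_x good sbs av) exprD mulrC.
Qed.

(** * Column sorting and multilinear tableaux *)

(** As row lengths weakly decrease, the rows reaching column [j] form an initial segment. *)
Lemma top_justified_column T j : sorted geq (shape T) ->
  column (cells T) j = mkseq (entry T ^~ j) (size (column (cells T) j)) /\
  forall i, (i < size (column (cells T) j)) = cell T i j.
Proof.
rewrite column_cells size_map; elim: T => [|s T IH] srt.
  by split=> // i; rewrite /cell nth_nil.
have [IH1 IH2] := IH (path_sorted srt).
have [js|sj] := ltnP j (size s).
  rewrite /= js; split=> [|[|i]]; last by rewrite ltnS IH2.
    rewrite /= IH1 /mkseq /=; congr cons.
    by rewrite -[1]/(1 + 0) iotaDl -map_comp.
  by rewrite /cell /= js.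
have le_geq : transitive geq by move=> a b c; lia.
have /allP small := order_path_min le_geq srt.
have none t : t \in T -> j < size t = false.
  by move=> /(map_f size) /small /=; lia.
have f0 : [seq t <- T | j < size t] = [::].
  by rewrite (@eq_in_filter _ _ pred0) ?filter_pred0.
rewrite /= ltnNge sj /= f0; split=> // -[|i]; rewrite /cell /=; first by lia.
have [iT|Ti] := ltnP i (size T); first by rewrite none ?mem_nth.
by rewrite nth_default.
Qed.

Lemma ltn_ext m n : (forall i, (i < m) = (i < n)) -> m = n.
Proof. by move=> H; have := H m; have := H n; lia. Qed.

(** The number of rows is compared separately because empty rows have no cells. *)
Lemma array_ext (T T' : array) : size T = size T' ->
  (forall i j, cell T i j = cell T' i j) ->
  (forall i j, cell T i j -> entry T i j = entry T' i j) -> T = T'.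
Proof.
move=> sz eqc eqe; apply: (@eq_from_nth _ [::]) => // i _.
have eqs : size (nth [::] T i) = size (nth [::] T' i).
  by apply: ltn_ext => j; apply: eqc.
by apply: (@eq_from_nth _ 0) => // j /eqe.
Qed.

Lemma sorted_columnE bs j : sorted_column bs j = sort leq (column (cells bs) j).
Proof. by rewrite /sorted_column column_cells. Qed.

Lemma size_sorted_column bs j :
  size (sorted_column bs j) = count (fun s => j < size s) bs.
Proof. by rewrite size_sort size_map size_filter. Qed.

(** The list of sorted columns is read as an array with the two indices exchanged; [sort_columns] is
    then its transpose. *)
Lemma sorted_columns_cell bs i j :
  cell (sorted_columns bs) j i = (i < size (sorted_column bs j)).
Proof.
rewrite /cell /sorted_columns; set m := \max_(s <- bs) size s.
have [jm|mj] := ltnP j m; first by rewrite nth_mkseq.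
rewrite nth_default ?size_mkseq // size_sorted_column.
rewrite (@eq_in_count _ _ pred0) ?count_pred0 // => s sbs /=.
by apply/negbTE; rewrite -leqNgt (leq_trans _ mj) // leq_bigmax_seq.
Qed.

Lemma sorted_columns_entry bs i j : cell (sorted_columns bs) j i ->
  entry (sorted_columns bs) j i = nth 0 (sorted_column bs j) i.
Proof.
rewrite /cell /entry /sorted_columns; set m := \max_(s <- bs) size s.
have [jm|mj] := ltnP j m; first by rewrite nth_mkseq.
by rewrite nth_default ?size_mkseq.
Qed.

Lemma sorted_columns_shape bs : sorted geq (shape (sorted_columns bs)).
Proof.
rewrite /shape -map_comp sorted_map; apply: sub_sorted (iota_ltn_sorted 0 _).
move=> i j ij; rewrite /= !size_sorted_column; apply: sub_count => s /=.
exact: ltn_trans.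
Qed.

Lemma sort_columns_row bs i :
  nth [::] (sort_columns bs) i = column (cells (sorted_columns bs)) i.
Proof.
rewrite /sort_columns; have [lt|ge] := ltnP i (size bs).
  by rewrite nth_mkseq // column_cells.
(* Past the last row both sides are empty, because no sorted column has more than [size bs]
   entries. *)
rewrite nth_default ?size_mkseq // [RHS](top_justified_column i _).1.
  suff -> : size (column (cells (sorted_columns bs)) i) = 0 by [].
  apply/eqP; rewrite -leqn0 leqNgt (top_justified_column i _).2.
    rewrite sorted_columns_cell size_sorted_column -leqNgt.
    exact: leq_trans (count_size _ _) ge.
  exact: sorted_columns_shape.
exact: sorted_columns_shape.
Qed.

Lemma sort_columns_cell bs i j :
  cell (sort_columns bs) i j = (i < size (sorted_column bs j)).
Proof.
rewrite /cell sort_columns_row (top_justified_column i _).2.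
  exact: sorted_columns_cell.
exact: sorted_columns_shape.
Qed.

Lemma sort_columns_entry bs i j : cell (sort_columns bs) i j ->
  entry (sort_columns bs) i j = nth 0 (sorted_column bs j) i.
Proof.
move=> cij; rewrite /entry sort_columns_row.
have [-> _] := top_justified_column i (sorted_columns_shape bs).
rewrite nth_mkseq; last by rewrite -sort_columns_row.
by rewrite sorted_columns_entry // sorted_columns_cell -sort_columns_cell.
Qed.

Lemma size_column0 bs : [::] \notin bs -> size (column (cells bs) 0) = size bs.
Proof.
move=> ne; rewrite column_cells size_map size_filter; apply/eqP.
rewrite -all_count; apply/allP.
by move=> s sbs; rewrite lt0n size_eq0; apply: contraNneq ne => <-.
Qed.

Lemma tableau_shape T (hT : multilinear_tableau T) : sorted geq (shape T).
Proof. by case: hT => /andP[]. Qed.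

Lemma tableau_nonempty T (hT : multilinear_tableau T) : [::] \notin T.
Proof.
by case: hT => /andP[_ + _ _ _ _]; apply: contra => /(map_f size).
Qed.

Lemma tableau_cell_up T (hT : multilinear_tableau T) i i' j :
  i' <= i -> cell T i j -> cell T i' j.
Proof.
have [_ cE] := top_justified_column j (tableau_shape hT).
by rewrite -!cE; apply: leq_ltn_trans.
Qed.

Lemma tableau_entry_lt T (hT : multilinear_tableau T) i i' j :
  i' < i -> cell T i j -> entry T i' j < entry T i j.
Proof.
have [_ _ _ _ col] := hT; elim: i => // i IH; rewrite ltnS leq_eqVlt.
move=> /orP[/eqP -> /col //|lt cij].
exact: ltn_trans (IH lt (tableau_cell_up hT (leqnSn _) cij)) (col _ _ cij).
Qed.

Lemma sorted_column_tableau T (hT : multilinear_tableau T) j :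
  sorted_column T j = column (cells T) j.
Proof.
rewrite sorted_columnE; apply: sorted_sort; first exact: leq_trans.
have [e cE] := top_justified_column j (tableau_shape hT); rewrite e.
rewrite sorted_pairwise; last exact: leq_trans.
apply/(pairwiseP 0) => i i'; rewrite !inE size_mkseq => iC iC' ii'.
by rewrite !nth_mkseq // ltnW // tableau_entry_lt // -cE.
Qed.

Lemma sort_columns_tableau T (hT : multilinear_tableau T) : sort_columns T = T.
Proof.
apply: array_ext => [|i j|i j cij]; first by rewrite size_mkseq.
  by rewrite sort_columns_cell (sorted_column_tableau hT) (top_justified_column _ (tableau_shape hT)).2.
rewrite sort_columns_entry // (sorted_column_tableau hT).
move: cij; rewrite sort_columns_cell (sorted_column_tableau hT) => ic.
by rewrite (top_justified_column j (tableau_shape hT)).1 nth_mkseq.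
Qed.

(** Sorting retains the multiset of entries of each column and forgets the rest, while a tableau has
    sorted columns already. The number of rows is the length of column 0, as no row is empty. *)
Lemma sort_columns_eq T (hT : multilinear_tableau T) bs : [::] \notin bs ->
  (sort_columns bs == T) = perm_eq (cells bs) (cells T).
Proof.
move=> ne; apply/eqP/idP => [e|pm].
  apply: perm_columns => j; rewrite perm_sym.
  suff -> : column (cells T) j = sorted_column bs j.
    by rewrite sorted_columnE perm_sort.
  have [eT cE] := top_justified_column j (tableau_shape hT).
  have sz : size (column (cells T) j) = size (sorted_column bs j).
    by apply: ltn_ext => i; rewrite cE -e sort_columns_cell.
  apply: (@eq_from_nth _ 0) => // i ic.
  rewrite eT nth_mkseq // -[T in entry T]e sort_columns_entry //.
  by rewrite e -cE.
have scE j : sorted_column bs j = sorted_column T j.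
  rewrite !sorted_columnE; apply/perm_sortP/perm_column => //.
  - exact: leq_total.
  - exact: leq_trans.
  - exact: anti_leq.
rewrite -[RHS](sort_columns_tableau hT); apply: array_ext => [|i j|i j cij].
- rewrite !size_mkseq -!size_column0 ?(tableau_nonempty hT) //.
  exact/perm_size/perm_column.
- by rewrite !sort_columns_cell scE.
- by rewrite !sort_columns_entry // ?scE // sort_columns_cell -scE -sort_columns_cell.
Qed.

(** * The statistic c as a number of free places *)

Lemma count_cells_column T j x : count (gtn x) (column (cells T) j) =
  \sum_(0 <= i < size T) (cell T i j && (entry T i j < x)).
Proof.
rewrite column_cells count_map count_filter count_sum_bool (big_nth [::]).
by apply: eq_bigr => i _; rewrite /= andbC.
Qed.

(** The rows above row [i] contribute [i] to both counts. From row [i] on, column [j.+1] has no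
    entry below the given one, so the difference is the part of column [j] counted by [c_stat]. *)
Lemma free_places_tableau T (hT : multilinear_tableau T) i j : cell T i j.+1 ->
  free_places (cells T) (j.+1, entry T i j.+1) = c_stat T i j.+1.
Proof.
move=> cij; have [_ _ _ row _] := hT.
have iT : i <= size T.
  by apply: ltnW; rewrite ltnNge; apply/negP => Ti; rewrite /cell nth_default in cij.
rewrite /free_places !count_cells_column /=.
have split_sum (F : nat -> nat) : \sum_(0 <= k < size T) F k =
    \sum_(0 <= k < i) F k + \sum_(i <= k < size T) F k.
  exact: big_cat_nat.
rewrite !split_sum.
rewrite [X in X + _ - _](_ : _ = i); last first.
  rewrite big_nat (eq_bigr (fun=> 1)) -?big_nat ?sum_nat_const_nat ?subn0 ?muln1 //.
  move=> i' /= i'i; have c' := tableau_cell_up hT (ltnW i'i) cij.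
  rewrite (_ : cell T i' j) /=; last exact: ltnW c'.
  by rewrite (ltn_trans (row _ _ c') (tableau_entry_lt hT i'i cij)).
rewrite [X in _ - (X + _)](_ : _ = i); last first.
  rewrite big_nat (eq_bigr (fun=> 1)) -?big_nat ?sum_nat_const_nat ?subn0 ?muln1 //.
  move=> i' /= i'i; rewrite (tableau_cell_up hT (ltnW i'i) cij).
  by rewrite (tableau_entry_lt hT i'i cij).
rewrite [X in _ - (_ + X)]big1_seq; last first.
  move=> i' /=; rewrite mem_index_iota => /andP[ii' _].
  case: (boolP (cell T i' j.+1)) => //= c'.
  move: ii'; rewrite leq_eqVlt => /orP[/eqP <-|lt]; first by rewrite ltnn.
  by rewrite ltnNge (ltnW (tableau_entry_lt hT lt c')).
rewrite addn0 addKn /c_stat big_mkcond [RHS]big_mkcond /=.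
by apply: eq_bigr => i' _; case: ifP.
Qed.

Lemma c_q_cells T (hT : multilinear_tableau T) :
  (c_q T = \prod_(y <- cells T | (0 < y.1)%N) q_int (free_places (cells T) y))%R.
Proof.
pose F y := q_int (free_places (cells T) y).
transitivity (\prod_(y <- cells T | (0 < y.1)%N) F y)%R; last by [].
rewrite /c_q /cells big_flatten big_map (big_nth [::]) big_mkord.
apply: eq_bigr => i _; rewrite /row_cells big_map.
set n := size _; have -> : iota 0 n = index_iota 0 n by rewrite /index_iota subn0.
(* The range starting at 1 becomes the full range under the condition of a positive column. *)
rewrite (@big_nat_widenl _ _ _ 1 0) //= big_nat_cond [RHS]big_nat_cond.
apply: eq_bigr => -[|j]; first by rewrite andbF.
by move=> /andP[/andP[_ js] _]; rewrite /F -(free_places_tableau hT).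
Qed.

(** * Set partitions and their lists of sorted blocks *)

Lemma mem_block_seq (S : {fset nat}) (B : {set S}) (x : S) :
  (val x \in block_seq B) = (x \in B).
Proof. by rewrite mem_sort mem_image //; apply: val_inj. Qed.

Lemma block_seq_inj (S : {fset nat}) : injective (@block_seq S).
Proof. by move=> B B' e; apply/setP => x; rewrite -!mem_block_seq e. Qed.

Lemma block_seqP (S : {fset nat}) (B : {set S}) (y : nat) :
  y \in block_seq B -> exists2 x : S, x \in B & val x = y.
Proof. by rewrite mem_sort => /imageP[x xB ->]; exists x. Qed.

Lemma block_seq_sorted (S : {fset nat}) (B : {set S}) :
  sorted ltn (block_seq B).
Proof.
rewrite ltn_sorted_uniq_leq sort_uniq sort_sorted ?andbT; last exact: leq_total.
by rewrite map_inj_uniq ?enum_uniq //; apply: val_inj.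
Qed.

Lemma mem_blocks (S : {fset nat}) (A : {set {set S}}) s :
  reflect (exists2 B, B \in A & s = block_seq B) (s \in blocks A).
Proof. by rewrite mem_sort; apply: imageP. Qed.

Lemma blocks_inj (S : {fset nat}) : injective (@blocks S).
Proof.
have sub (A A' : {set {set S}}) : blocks A = blocks A' -> A \subset A'.
  move=> e; apply/subsetP => B BA.
  have /mem_blocks[B' BA' /block_seq_inj -> //] : block_seq B \in blocks A'.
  by rewrite -e; apply/mem_blocks; exists B.
by move=> A A' e; apply/eqP; rewrite eqEsubset !sub.
Qed.

Lemma blocks_nonempty (S : {fset nat}) (A : {set {set S}}) :
  set0 \notin A -> [::] \notin blocks A.
Proof.
apply: contra => /mem_blocks[B BA e]; suff <- : B = set0 by [].
by apply/setP => x; rewrite -mem_block_seq -e in_set0.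
Qed.

(** Two blocks with the same head share an element and so coincide by disjointness; distinct heads
    make the weak order strict. *)
Lemma blocks_heads_sorted (S : {fset nat}) (A : {set {set S}}) :
  trivIset A -> set0 \notin A -> sorted ltn [seq head 0 s | s <- blocks A].
Proof.
move=> /trivIsetP tA A0; rewrite ltn_sorted_uniq_leq; apply/andP; split; last first.
  by rewrite sorted_map; apply: sort_sorted => s t; apply: leq_total.
rewrite (perm_uniq (perm_map _ (permEl (perm_sort _ _)))) -map_comp.
rewrite map_inj_in_uniq ?enum_uniq // => B B'; rewrite !mem_enum => BA BA' /= e.
have head_in C : C \in A -> head 0 (block_seq C) \in block_seq C.
  move=> CA; have : block_seq C \in blocks A by apply/mem_blocks; exists C.
  case: (block_seq C) => [|a s _]; last by rewrite mem_head.
  by rewrite (negbTE (blocks_nonempty A0)).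
have [x xB xE] := block_seqP (head_in B BA).
have [x' xB' xE'] := block_seqP (head_in B' BA').
have xx : x = x' by apply: val_inj; rewrite xE xE'.
apply/eqP; apply: contraT => /(tA _ _ BA BA') /disjoint_setI0 /setP /(_ x).
by rewrite !inE xB xx xB'.
Qed.

Lemma row_unique (bs : array) (s t : seq nat) x : uniq (flatten bs) ->
  s \in bs -> t \in bs -> x \in s -> x \in t -> s = t.
Proof.
elim: bs => //= r bs IH; rewrite cat_uniq => /and3P[_ /hasPn dis u].
rewrite !inE => /orP[/eqP ->|sb] /orP[/eqP ->|tb] // xs xt.
- have /dis : x \in flatten bs by apply/flattenP; exists t.
  by rewrite /= xs.
- have /dis : x \in flatten bs by apply/flattenP; exists s.
  by rewrite /= xt.
- exact: IH.
Qed.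

(** Each row is the sorted list of its own set of entries, and these sets are the blocks of the
    required partition. *)
Lemma blocks_onto (S : {fset nat}) (bs : array) :
  all (sorted ltn) bs -> [::] \notin bs ->
  sorted ltn [seq head 0 s | s <- bs] ->
  uniq (flatten bs) -> flatten bs =i S ->
  exists2 A : {set {set S}}, partition A [set: S] & blocks A = bs.
Proof.
move=> /allP srt ne hd u bsS.
pose row_set (s : seq nat) := [set x : S | val x \in s].
have row_setK s : s \in bs -> block_seq (row_set s) = s.
  move=> sbs; apply: (irr_sorted_eq ltn_trans ltnn _ (srt s sbs)).
    exact: block_seq_sorted.
  move=> y; apply/idP/idP => [/block_seqP[x + <-]|ys]; first by rewrite inE.
  have yS : y \in S by rewrite -bsS; apply/flattenP; exists s.
  by rewrite -[y]/(val [` yS]%fset) mem_block_seq inE.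
(* Membership is tested on the sorted list, so that nonempty and disjoint blocks follow from the
   same properties of the rows of [bs]. *)
pose A := [set B : {set S} | block_seq B \in bs].
have A0 : set0 \notin A.
  rewrite inE; suff -> : block_seq (set0 : {set S}) = [::] by [].
  by case e: (block_seq _) => [|y l] //; have := mem_head y l;
     rewrite -e => /block_seqP[x]; rewrite inE.
have tA : trivIset A.
  apply/trivIsetP => B B'; rewrite !inE => BA BA'; apply: contraNT.
  case/pred0Pn=> x /= /andP[xB xB']; apply/eqP/block_seq_inj.
  by apply: (row_unique u BA BA' (x := val x)); rewrite mem_block_seq.
exists A.
  rewrite /partition tA A0 !andbT eqEsubset subsetT /=; apply/subsetP => x _.
  have : val x \in flatten bs by rewrite bsS; apply: valP.
  case/flattenP=> s sbs xs; apply/bigcupP; exists (row_set s); rewrite !inE //.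
  by rewrite row_setK.
(* Both lists are strictly sorted by heads, so it suffices that they have the same members. *)
have lt_trans : transitive (relpre (head 0) ltn).
  by move=> a b c; apply: ltn_trans.
have lt_irr : irreflexive (relpre (head 0) ltn) by move=> a; apply: ltnn.
apply: (irr_sorted_eq lt_trans lt_irr).
- by rewrite -sorted_map blocks_heads_sorted.
- by rewrite -sorted_map.
move=> s; apply/mem_blocks/idP => [[B + ->]|sbs]; first by rewrite inE.
by exists (row_set s); rewrite ?inE row_setK.
Qed.

(** * From arrays with the cells of [T] to set partitions *)

Theorem theorem3p5 (T : array) (hT : multilinear_tableau T) :
  c_q T =
  (\sum_(A : {set {set supp T}} |
         partition A [set: supp T] && (tableau_of A == T))
     'X^(v_stat A))%R.
Proof.
(* Sorting uses the reflexive closure, which is total; strictness is recovered from the distinctness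
   of the cells. *)
pose lexge y z := (y == z) || lexgt y z.
pose w := sort lexge (cells T).
have pw : perm_eq (cells T) w by rewrite perm_sym perm_sort.
have uT : uniq (flatten T) by case: hT.
have uw : uniq [seq y.2 | y <- w].
  by rewrite -(perm_uniq (perm_map _ pw)) cells_snd.
have srt : sorted lexgt w.
  have ge_total : total lexge.
    by move=> [a b] [c d]; rewrite /lexge /lexgt !xpair_eqE /=; lia.
  have ge_trans : transitive lexge.
    by move=> [a b] [c d] [e f]; rewrite /lexge /lexgt !xpair_eqE /=; lia.
  have := sort_sorted ge_total (cells T); rewrite -/w.
  rewrite !sorted_pairwise //; last exact: lexgt_trans.
  move: (map_uniq uw); rewrite uniq_pairwise => ud ge.
  have := conj ud ge; move/andP; rewrite -pairwise_relI.
  by apply: sub_pairwise => y z /andP[/= /negbTE yz]; rewrite /lexge yz.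
rewrite (c_q_cells hT) (perm_big _ pw) /=.
(* Free places are counts within columns, hence independent of the order of the cells. *)
have fpE y : free_places (cells T) y = free_places w y.
  by rewrite /free_places; congr (_ - _); apply/seq.permP/perm_column.
under eq_bigr do rewrite fpE.
rewrite -sum_block_arrays //.
pose P (A : {set {set supp T}}) :=
  partition A [set: supp T] && (tableau_of A == T).
(* Both lists are free of repetitions, so only membership is compared: [blocks_onto] gives one
   direction, and [sort_columns_eq] translates the tableau condition into equality of cells. *)
have perm_blocks : perm_eq (block_arrays w) [seq blocks A | A in P].
  apply: uniq_perm => [||bs].
  - exact: block_arrays_uniq.
  - by rewrite map_inj_uniq ?enum_uniq //; apply: blocks_inj.
  rewrite mem_block_arrays //; apply/idP/imageP => [/and4P[rows ne hd pm]|[A PA ->]].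
    have pT : perm_eq (flatten bs) (flatten T).
      by rewrite -!cells_snd perm_map // (perm_trans pm) // perm_sym.
    have [||A pA AE] := @blocks_onto (supp T) bs rows ne hd.
    - by rewrite (perm_uniq pT).
    - by move=> x; rewrite (perm_mem pT) inE.
    exists A => //; rewrite unfold_in /P pA /= /tableau_of AE.
    by rewrite (sort_columns_eq hT ne) (perm_trans pm) // perm_sym.
  case/andP: PA => /and3P[_ tA A0]; have ne := blocks_nonempty A0.
  rewrite (sort_columns_eq hT ne) => pm; apply/and4P; split=> //.
  - by apply/allP => s /mem_blocks[B _ ->]; apply: block_seq_sorted.
  - exact: blocks_heads_sorted.
  - exact: perm_trans pm pw.
by rewrite (perm_big _ perm_blocks) big_image.
Qed.
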